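(* Let $\mu\in\mathcal M(\mathbb R^d)$ and $\alpha\in\mathbb R$. For any $x\notin\operatorname{int}(D_\alpha(\mu))$ and any $F\in\mathfrak F(x,D_\alpha(\mu))$ there exists $H(x,F)\in\mathcal H(D_\alpha(\mu),F)$ such that $x\in H(x,F)$ and $\mu(\operatorname{int}(H(x,F)))\le\alpha$. In particular, $$\left(\operatorname{int}(D_\alpha(\mu))\right)^{\mathsf c}=\bigcup\{H\in\mathcal H(D_\alpha(\mu)):\mu(\operatorname{int}(H))\le\alpha\}.$$ Additionally: (i) if $\mu$ is smooth at $D_\alpha(\mu)$, then $\mu(H(x,F))=\alpha$ and $$\left(\operatorname{int}(D_\alpha(\mu))\right)^{\mathsf c}=\bigcup\{H\in\mathcal H(D_\alpha(\mu)):\mu(H)=\alpha\};$$ (ii) if $\mu$ has contiguous support at $D_\alpha(\mu)$, then $$\left(\operatorname{int}(D_\alpha(\mu))\right)^{\mathsf c}=\bigcup\{H\in\mathcal H:\mu(\operatorname{int}(H))\le\alpha\};$$ (iii) if $\mu$ is smooth at $D_\alpha(\mu)$ and has contiguous support at $D_\alpha(\mu)$, then $$\left(\operatorname{int}(D_\alpha(\mu))\right)^{\mathsf c}=\bigcup\{H\in\mathcal H:\mu(H)=\alpha\}.$$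
   Context: $\mathcal M(\mathbb R^d)$ is the set of finite Borel measures on $\mathbb R^d$. $\mathcal H$ is the set of closed halfspaces $H_{x,u}=\{y\in\mathbb R^d:\langle x,u\rangle\le\langle y,u\rangle\}$, $x\in\mathbb R^d$, $u\in\mathbb S^{d-1}$ (the unit sphere); $\mathcal H(x)=\{H_{x,u}:u\in\mathbb S^{d-1}\}$. $A^{\mathsf c}=\mathbb R^d\setminus A$; $\operatorname{int},\operatorname{cl},\operatorname{bd},\operatorname{relint},\operatorname{conv}$ denote interior, closure, boundary, relative interior, convex hull. Halfspace depth: $D(x;\mu)=\inf_{H\in\mathcal H(x)}\mu(H)$. $D_\alpha(\mu)=\{x\in\mathbb R^d:D(x;\mu)\ge\alpha\}$ (a closed convex set). Touching halfspaces: for a non-empty convex set $A$, $\mathcal H(A)=\{H\in\mathcal H: H\cap\operatorname{cl}(A)\ne\emptyset,\ \operatorname{int}(H)\cap A=\emptyset\}$; $\mathcal H(\emptyset)=\mathcal H$. A face of a convex set $A$ is a convex subset $F\subseteq A$ such that $x,y\in A$ and $(x+y)/2\in F$ imply $x,y\in F$ (the empty set is a face); $\mathcal F(A)$ is the set of all faces of $\operatorname{cl}(A)$. For $F\in\mathcal F(A)$, $\mathcal H(A,F)=\{H\in\mathcal H(A):F\subseteq\operatorname{bd}(H)\}$. For $A$ convex and $x\notin\operatorname{int}(A)$: $\mathfrak F(x,A)=\{F\in\mathcal F(A):\operatorname{relint}(\operatorname{conv}(F\cup\{x\}))\cap\operatorname{cl}(A)=\emptyset\}$ if $x\notin\operatorname{cl}(A)$,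 and $\mathfrak F(x,A)=\{F\in\mathcal F(A):x\in\operatorname{relint}(F)\}$ if $x\in\operatorname{bd}(A)$; in particular $\mathfrak F(x,\emptyset)=\{\emptyset\}$. For a convex proper subset $A\subsetneq\mathbb R^d$: $\mu$ is smooth at $A$ if $\mu(\operatorname{bd}(H))=0$ for all $H\in\mathcal H(A)$; $\mu$ has contiguous support at $A$ if for each $H'\in\mathcal H(A)$ and each $H\in\mathcal H$ with $H'\subsetneq H$, $\operatorname{bd}(H)\cap\operatorname{int}(A)\neq\emptyset$ implies $\mu(H')<\mu(H)$. (These two conditions are only defined for proper subsets, so assuming either of them at $D_\alpha(\mu)$ includes $D_\alpha(\mu)\ne\mathbb R^d$.)
   Formalization: In (i) and (iii), when D_α(μ) is empty, it is additionally assumed that some closed halfspace H has μ(H) ≥ α; otherwise both parts fail, e.g. for d ≥ 1, μ = 0, α = 1. *)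

(* Defs.v *)
(* MathComp-Analysis *)
From HB Require Import structures.
From mathcomp Require Import all_boot all_order all_algebra.
From mathcomp Require Import all_classical all_reals all_analysis.
Import Order.TTheory GRing.Theory Num.Theory.
Import numFieldNormedType.Exports.

Set Implicit Arguments.
Unset Strict Implicit.
Unset Printing Implicit Defensive.

Local Open Scope classical_set_scope.
Local Open Scope ring_scope.

(* The library puts no sigma-algebra on row vectors, hence the alias.  The norm
   of 'rV[R]_d is the sup norm, whose topology is the Euclidean one. *)
Definition borelRn (R : realType) (d : nat) :=
  g_sigma_algebraType (@open 'rV[R]_d).

Section ConvexGeometry.
Context {R : realType} {d : nat}.
Implicit Types (A C F H : set 'rV[R]_d) (x y u : 'rV[R]_d).

Definition inner x y : R := \sum_(i < d) x 0 i * y 0 i.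

Definition unit_sphere : set 'rV[R]_d := [set u | inner u u = 1].

Definition halfspace x u : set 'rV[R]_d := [set y | inner x u <= inner y u].

Definition halfspaces_at x : set (set 'rV[R]_d) :=
  [set halfspace x u | u in unit_sphere].

Definition halfspaces : set (set 'rV[R]_d) :=
  \bigcup_(x in [set: 'rV[R]_d]) halfspaces_at x.

Definition bd A : set 'rV[R]_d := closure A `\` interior A.

Definition conv_hull A : set 'rV[R]_d :=
  smallest (@convex_set R 'rV[R]_d) A.

Definition affine_set A : Prop :=
  forall x y (t : R), A x -> A y -> A (t *: x + (1 - t) *: y).

Definition affine_hull A : set 'rV[R]_d := smallest affine_set A.

Definition relint A : set 'rV[R]_d :=
  [set x | A x /\ \forall y \near x, affine_hull A y -> A y].

Definition is_face C F : Prop :=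
  [/\ @convex_set R 'rV[R]_d F, F `<=` C
    & forall x y, C x -> C y -> F (2^-1 *: (x + y)) -> F x /\ F y].

Definition faces A : set (set 'rV[R]_d) := [set F | is_face (closure A) F].

Definition touching A : set (set 'rV[R]_d) :=
  [set H | halfspaces H /\
    (A !=set0 -> H `&` closure A !=set0 /\ interior H `&` A = set0)].

Definition touching_along A F : set (set 'rV[R]_d) :=
  [set H | touching A H /\ F `<=` bd H].

(* Meaningful for x outside the interior of A: either x is not in the closure
   of A, or it is a boundary point. *)
Definition visible_faces x A : set (set 'rV[R]_d) :=
  [set F | faces A F /\
    ((~ closure A x /\ relint (conv_hull (F `|` [set x])) `&` closure A = set0)
     \/ (bd A x /\ relint F x))].

End ConvexGeometry.

Section Depth.
Context {R : realType} {d : nat}.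
Variable mu : {finite_measure set (borelRn R d) -> \bar R}.
Implicit Types (A H : set 'rV[R]_d) (x : 'rV[R]_d) (alpha : R).
Local Open Scope ereal_scope.

Definition depth x : \bar R := ereal_inf [set mu H | H in halfspaces_at x].

Definition depth_region alpha : set 'rV[R]_d := [set x | alpha%:E <= depth x].

(* Smoothness and contiguous support are notions for proper subsets only, so
   properness is part of both definitions. *)
Definition smooth_at A : Prop :=
  A <> [set: 'rV[R]_d] /\ forall H, touching A H -> mu (bd H) = 0.

Definition contiguous_support_at A : Prop :=
  A <> [set: 'rV[R]_d] /\
  forall H' H, touching A H' -> halfspaces H -> H' `<` H ->
    bd H `&` interior A !=set0 -> mu H' < mu H.

(* Automatic when the depth region of level alpha is non-empty and d > 0; it
   can fail when the region is empty, e.g. as soon as alpha > mu setT, and then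
   no halfspace has measure alpha. *)
Definition level_reached alpha : Prop :=
  exists2 H, halfspaces H & alpha%:E <= mu H.

End Depth.

(* Main.v *)
Require Import Defs.
From HB Require Import structures.
From mathcomp Require Import all_boot all_order all_algebra.
From mathcomp Require Import all_classical all_reals all_analysis.
From mathcomp Require Import ring lra.
Import Order.TTheory GRing.Theory Num.Theory.
Import numFieldNormedType.Exports.

(** Write [D] for the depth region of level [alpha].  A point lies outside [D]
    exactly when some closed halfspace bounded by a hyperplane through it is
    light, that is, has mass less than [alpha]; a light halfspace misses [D]
    altogether, because the parallel halfspaces through its points are
    contained in it, hence light as well.  Continuity of the measure from above
    makes [D] closed, and for [D] different from the whole space it makes [D]
    compact.

    The main device is [supporting_limit].  Let points [y] outside [D] converge
    to [f], and choose for each of them a light halfspace with inner normal [v].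
    The unit sphere being compact, the normals accumulate at some [u], and the
    halfspace through [f] with normal [u] inherits everything closed about the
    approximating ones: [D] stays on its other side, and the mass of its
    interior is at most [alpha] by lower semicontinuity
    ([measure_open_halfspace_le]).  If moreover the [y] lie on the segment from
    a point [f] of [D] to [x], then the normals [v] have positive product with
    [x - f], so the limit halfspace contains [x].

    It remains to choose [f].  For [x] on the boundary of [D], take [f := x] and
    approach it by points outside [D].  For [x] outside [D], let [f] be a
    relative interior point of the face [F]: by visibility the open segment from
    [f] to [x], which consists of relative interior points of the cone over [F]
    ([relint_cone]), misses [D].  When [F] is empty, a nearest point of [D] plays
    the role of [f].  In all cases with [F] nonempty, the linear form of normal
    [u] attains its maximum over [F] at a relative interior point, hence is
    constant on [F] ([relint_max_constant]), and [F] lies in the bounding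
    hyperplane.

    If [mu] is smooth at [D] and [D] is nonempty, the mass of the halfspace is at
    least [alpha] since [f] is in [D], and at most [alpha] since the boundary is
    null.  If [D] is empty, all halfspaces are touching; a light halfspace
    through [x] is then enlarged by translation until its mass is exactly
    [alpha] ([exists_halfspace_level]).  This needs a total mass above [alpha];
    if the total mass equals [alpha], a halfspace reaching the level carries the
    whole measure, and so does every translate containing it.

    For the reverse inclusions, a touching halfspace cannot meet the interior of
    [D]; and under contiguous support neither can a halfspace whose interior has
    mass at most [alpha], for it would have more mass than the parallel touching
    halfspace, whose mass is at least [alpha] ([contiguous_disjoint]). *)

Set Implicit Arguments.
Unset Strict Implicit.
Unset Printing Implicit Defensive.

Local Open Scope classical_set_scope.
Local Open Scope ring_scope.

(** * Inner products and halfspaces *)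

Section InnerProduct.
Context {R : realType} {d : nat}.
Implicit Types (x y z u v : 'rV[R]_d).

Lemma innerC x y : inner x y = inner y x.
Proof. by apply: eq_bigr => i _; rewrite mulrC. Qed.

Lemma innerDl x y u : inner (x + y) u = inner x u + inner y u.
Proof.
by rewrite /inner -big_split/=; apply: eq_bigr => i _; rewrite mxE mulrDl.
Qed.

Lemma innerZl (a : R) x u : inner (a *: x) u = a * inner x u.
Proof.
by rewrite /inner mulr_sumr; apply: eq_bigr => i _; rewrite mxE mulrA.
Qed.

Lemma innerBl x y u : inner (x - y) u = inner x u - inner y u.
Proof. by rewrite -scaleN1r innerDl innerZl mulN1r. Qed.

Lemma innerBr x u v : inner x (u - v) = inner x u - inner x v.
Proof. by rewrite innerC innerBl !(innerC x). Qed.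

Lemma inner_unit u : unit_sphere u -> inner u u = 1.
Proof. by []. Qed.

Lemma coord_le_norm x (i : 'I_d) : `|x 0 i| <= `|x|.
Proof.
rewrite [leRHS]/Num.norm /= mx_normrE; apply/bigmax_geP; right => /=.
by exists (0, i).
Qed.

(** Crude Cauchy--Schwarz inequality for the sup norm. *)
Lemma inner_le_norm x y : `|inner x y| <= d%:R * (`|x| * `|y|).
Proof.
apply: le_trans (ler_norm_sum _ _ _) _.
have -> : d%:R * (`|x| * `|y|) = \sum_(i < d) (`|x| * `|y|).
  by rewrite sumr_const card_ord mulr_natl.
by apply: ler_sum => i _; rewrite normrM ler_pM// coord_le_norm.
Qed.

(** Robustness of strict separation under perturbation of the anchor point and
    the direction; the tolerance depends only on the margin [c] and the bound
    [k], so it serves all the points of a bounded set at once. *)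
Lemma inner_stable (c k : R) : 0 < c -> 0 <= k ->
  exists2 e, 0 < e & forall z f y u v, c <= inner (z - f) u -> `|z - f| <= k ->
    `|y - f| < e -> `|v - u| < e -> `|v| <= 1 -> 0 < inner (z - y) v.
Proof.
move=> c0 k0.
have d0 : 0 < d%:R + 1 :> R by rewrite ltr_wpDl.
have k1 : 0 < k + 1 by rewrite ltr_wpDl.
pose e := c / ((d%:R + 1) * (k + 1)).
have e0 : 0 < e by rewrite divr_gt0// mulr_gt0.
have small : d%:R * (k * e) + d%:R * (e * 1) < c.
  have -> : d%:R * (k * e) + d%:R * (e * 1) = d%:R / (d%:R + 1) * c.
    by rewrite /e; field; rewrite !gt_eqF.
  by rewrite gtr_pMl// ltr_pdivrMr// mul1r ltrDl.
exists e => // z f y u v cz zf yf vu v1.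
have zvu : d%:R * (`|z - f| * `|v - u|) <= d%:R * (k * e).
  by rewrite ler_wpM2l// ler_pM// ltW.
have yfv : d%:R * (`|y - f| * `|v|) <= d%:R * (e * 1).
  by rewrite ler_wpM2l// ler_pM// ltW.
have := le_trans (inner_le_norm (z - f) (v - u)) zvu.
have := le_trans (inner_le_norm (y - f) v) yfv.
rewrite !innerBl !innerBr !ler_norml in cz * => /andP[_ +] /andP[+ _].
move: cz small; move: (d%:R * (k * e)) (d%:R * (e * 1)) => a1 a2.
lra.
Qed.

Lemma continuous_inner2 (T : topologicalType) (f g : T -> 'rV[R]_d) :
  continuous f -> continuous g -> continuous (fun t => inner (f t) (g t)).
Proof.
move=> cf cg; apply: continuous_big => [|i _ t].
  exact: add_continuous.
have coord (h : T -> 'rV[R]_d) :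
    continuous h -> {for t, continuous (fun s => h s 0 i)}.
  move=> ch; apply: (@continuous_comp _ _ _ h (fun M : 'rV[R]_d => M 0 i)).
    exact: ch.
  exact: coord_continuous.
by apply: cvgM; exact: coord.
Qed.

Lemma continuous_innerl u : continuous (inner ^~ u).
Proof. by apply: continuous_inner2 => t; [move=> A | exact: cst_continuous]. Qed.

Lemma unit_sphere_norm u : unit_sphere u -> `|u| <= 1.
Proof.
move=> uu; rewrite [leLHS]/Num.norm /= mx_normrE; apply/bigmax_leP; split => //=.
move=> [i j] _ /=; rewrite (ord1 i) -[leRHS]sqrtr1 -sqrtr_sqr ler_sqrt//.
rewrite -(inner_unit uu) /inner (bigD1 j)//= -expr2 lerDl.
by apply: sumr_ge0 => k _; rewrite -expr2 sqr_ge0.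
Qed.

Lemma compact_unit_sphere : compact (@unit_sphere R d).
Proof.
apply: bounded_closed_compact.
  exists 1; split; first exact: num_real.
  by move=> M M1 u /unit_sphere_norm uu; exact: le_trans uu (ltW M1).
have -> : @unit_sphere R d = (fun u => inner u u) @^-1` [set 1] by [].
apply: closed_comp => [u _|]; last exact: closed_eq.
by apply: continuous_inner2 => t A.
Qed.

Definition open_halfspace x u : set 'rV[R]_d := [set y | inner x u < inner y u].

Lemma halfspaceS x y u : inner x u <= inner y u -> halfspace y u `<=` halfspace x u.
Proof. by move=> xy z /=; exact: le_trans. Qed.

Lemma open_halfspaceW x u : open_halfspace x u `<=` halfspace x u.
Proof. by move=> y /ltW. Qed.

Lemma halfspaces_halfspace x u : unit_sphere u -> halfspaces (halfspace x u).
Proof. by move=> uu; exists x => //; exists u. Qed.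

Lemma closed_halfspace x u : closed (halfspace x u).
Proof.
have -> : halfspace x u = (inner ^~ u) @^-1` [set r | inner x u <= r] by [].
apply: closed_comp => [y _|]; [exact: continuous_innerl|exact: closed_ge].
Qed.

Lemma open_open_halfspace x u : open (open_halfspace x u).
Proof.
have -> : open_halfspace x u = (inner ^~ u) @^-1` [set r | inner x u < r] by [].
apply: open_comp => [y _|]; [exact: continuous_innerl|exact: open_gt].
Qed.

Lemma interior_step (A : set 'rV[R]_d) x u : interior A x ->
  exists2 e, 0 < e & forall s, `|s| <= e -> A (x + s *: u).
Proof.
move=> /nbhs_ballP[e/= e0 eA].
have n0 : 0 < `|u| + 1 by rewrite ltr_wpDl.
exists (e / 2 / (`|u| + 1)); first by rewrite !divr_gt0.
move=> s se; apply: eA; rewrite -ball_normE /= opprD addrA subrr sub0r normrN.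
rewrite normrZ (@le_lt_trans _ _ (e / 2))//; last first.
  by rewrite ltr_pdivrMr// ltr_pMr// ltr1n.
rewrite -[leRHS](divfK (lt0r_neq0 n0)) ler_pM// ?ler_wpDr//.
Qed.

Lemma interior_halfspace x u : unit_sphere u ->
  interior (halfspace x u) = open_halfspace x u.
Proof.
move=> uu; apply/seteqP; split; last first.
  rewrite -open_subsetE; [exact: open_halfspaceW|exact: open_open_halfspace].
move=> y /(interior_step u) [e e0 /(_ (- e))].
rewrite normrN gtr0_norm// => /(_ (lexx _)).
rewrite /halfspace/open_halfspace/= innerDl innerZl (inner_unit uu) mulr1; lra.
Qed.

Lemma bd_halfspace x u : unit_sphere u ->
  bd (halfspace x u) = [set y | inner y u = inner x u].
Proof.
move=> uu; rewrite /bd (interior_halfspace x uu).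
have /closure_id <- := @closed_halfspace x u.
apply/seteqP; split => y /=; rewrite /open_halfspace/=.
  by move=> [xy /negP]; rewrite -leNgt => yx; apply/eqP; rewrite eq_le xy yx.
by rewrite /halfspace/= => ->; rewrite lexx ltxx; split.
Qed.

End InnerProduct.

(** * Relative interiors of convex sets *)

Section RelativeInterior.
Context {R : realType} {d : nat}.
Implicit Types (x y z u v : 'rV[R]_d) (A C F : set 'rV[R]_d).

Lemma convex_set_segment C x y (t : R) : @convex_set R 'rV[R]_d C ->
  C x -> C y -> 0 <= t -> t <= 1 -> C (t *: x + (1 - t) *: y).
Proof.
move=> cC Cx Cy t0 t1; have t01 : 0 <= t <= 1 by rewrite t0.
by have := cC x y (Itv01 t0 t1); rewrite !inE; exact.
Qed.

Lemma affine_set_convex A : affine_set A -> @convex_set R 'rV[R]_d A.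
Proof. by move=> aA x y t; rewrite !inE => Ax Ay; exact: aA. Qed.

Lemma convex_set_sum C n (w : 'I_n -> 'rV[R]_d) (c : 'I_n -> R) :
  @convex_set R 'rV[R]_d C -> (forall i, C (w i)) -> (forall i, 0 <= c i) ->
  \sum_i c i = 1 -> C (\sum_i c i *: w i).
Proof.
move=> cC; elim: n w c => [|n IH] w c Cw c0.
  by rewrite big_ord0 => /esym/eqP; rewrite oner_eq0.
rewrite !big_ord_recr/=; set s := \sum_(i < n) _ => sc.
have s0 : 0 <= s by apply: sumr_ge0.
have [s00|sn0] := eqVneq s 0.
  rewrite big1 ?add0r => [|i _].
    by move: sc; rewrite s00 add0r => ->; rewrite scale1r.
  have /(_ i) : forall i, c (widen_ord (leqnSn n) i) = 0.
    by move=> j; exact: (psumr_eq0P _ s00).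
  by move=> ->; rewrite scale0r.
have -> : \sum_(i < n) c (widen_ord (leqnSn n) i) *: w (widen_ord (leqnSn n) i)
    = s *: \sum_(i < n) (c (widen_ord (leqnSn n) i) / s) *: w (widen_ord (leqnSn n) i).
  by rewrite scaler_sumr; apply: eq_bigr => i _; rewrite scalerA mulrC divfK.
have -> : c ord_max = 1 - s by rewrite -sc addrC addrK.
apply: convex_set_segment => //.
- apply: IH => // [i|]; first by rewrite divr_ge0.
  by rewrite -mulr_suml divff.
- by rewrite -sc lerDl.
Qed.

Lemma convex_conv_hull A : @convex_set R 'rV[R]_d (conv_hull A).
Proof.
move=> x y t; rewrite !inE => Ax Ay B [cB AB].
have := cB x y t; rewrite !inE; apply.
- by apply: Ax; split.
- by apply: Ay; split.
Qed.

Lemma sub_conv_hull A : A `<=` conv_hull A.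
Proof. by move=> x Ax B [_]; exact. Qed.

(** The lift of [x] to the affine hyperplane at height 1: affine relations
    between points become linear relations between their lifts. *)
Definition homogeneous x : 'rV[R]_(d + 1) := row_mx x (const_mx 1).

Definition homogeneous_mx n (w : 'I_n -> 'rV[R]_d) : 'M[R]_(n, d + 1) :=
  \matrix_i homogeneous (w i).

Definition affine_span n (w : 'I_n -> 'rV[R]_d) : set 'rV[R]_d :=
  [set x | (homogeneous x <= homogeneous_mx w)%MS].

Lemma affine_span_affine n (w : 'I_n -> 'rV[R]_d) : affine_set (affine_span w).
Proof.
move=> x y t; rewrite /affine_span/= => wx wy.
have -> : homogeneous (t *: x + (1 - t) *: y)
    = t *: homogeneous x + (1 - t) *: homogeneous y.
  rewrite /homogeneous !scale_row_mx add_row_mx; congr row_mx.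
  by apply/rowP => i; rewrite !mxE; lra.
by rewrite addmx_sub// scalemx_sub.
Qed.

Lemma affine_span_mem n (w : 'I_n -> 'rV[R]_d) i : affine_span w (w i).
Proof.
rewrite /affine_span/=; have <- : row i (homogeneous_mx w) = homogeneous (w i).
  exact: rowK.
exact: row_sub.
Qed.

(** The coefficients expressing a small displacement inside the affine span are
    small, so they do not spoil the positivity of the weights. *)
Lemma relint_sum C n (w : 'I_n -> 'rV[R]_d) (c : 'I_n -> R) :
  @convex_set R 'rV[R]_d C -> (forall i, C (w i)) -> C `<=` affine_span w ->
  (forall i, 0 < c i) -> \sum_i c i = 1 -> relint C (\sum_i c i *: w i).
Proof.
move=> cC Cw Csp c0 c1; set p := \sum_i _.
have Cp : C p by apply: convex_set_sum => // i; exact: ltW.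
split=> //; set M := homogeneous_mx w.
(* the pseudo-inverse gives each coefficient of a displacement as the inner
   product of the displacement with a fixed vector [q i] *)
pose q i : 'rV[R]_d := (col i (usubmx (pinvmx M)))^T.
have near_p : \forall y \near p, forall i, `|inner p (q i) - inner y (q i)| < c i.
  apply: (@filter_forall _ _
    (fun i y => `|inner p (q i) - inner y (q i)| < c i) (nbhs p)) => i.
  by have /cvgrPdist_lt/(_ _ (c0 i)) := @continuous_innerl R d (q i) p.
near=> y => /(_ (affine_span w)) /(_ (conj (@affine_span_affine n w) Csp)) spy.
have small : forall i, `|inner p (q i) - inner y (q i)| < c i by near: y.
pose e i := inner (y - p) (q i).
have eE : \row_i e i = row_mx (y - p) 0 *m pinvmx M.
  rewrite -[pinvmx M]vsubmxK mul_row_col mul0mx addr0.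
  by apply/rowP => i; rewrite !mxE; apply: eq_bigr => j _; rewrite !mxE.
have hom_sub : homogeneous y - homogeneous p = row_mx (y - p) 0.
  by rewrite /homogeneous opp_row_mx add_row_mx subrr.
have eM : \sum_i e i *: homogeneous (w i) = row_mx (y - p) 0.
  have <- : \row_i e i *m M = row_mx (y - p) 0.
    by rewrite eE mulmxKpV// -hom_sub addmx_sub// ?eqmx_opp//; exact: Csp.
  rewrite mulmx_sum_row; apply: eq_bigr => i _.
  by rewrite mxE rowK.
have e_sum : \sum_i e i *: w i = y - p.
  have /(congr1 lsubmx) := eM; rewrite row_mxKl linear_sum/= => <-.
  by apply: eq_bigr => i _; rewrite linearZ/= row_mxKl.
have e0 : \sum_i e i = 0.
  have /(congr1 rsubmx) := eM; rewrite row_mxKr linear_sum/= => /rowP/(_ 0).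
  rewrite summxE [RHS]mxE => {2}<-; apply: eq_bigr => i _.
  by rewrite linearZ/= row_mxKr !mxE mulr1.
have -> : y = \sum_i (c i + e i) *: w i.
  under eq_bigr do rewrite scalerDl.
  by rewrite big_split/= e_sum -/p addrC subrK.
apply: convex_set_sum => // [i|].
  have := small i; rewrite /e innerBl ltr_norml => /andP[]; lra.
by rewrite big_split/= c1 e0 addr0.
Unshelve. all: by end_near. Qed.

Lemma widen_lift_max n (i : 'I_n) : widen_ord (leqnSn n) i = lift ord_max i.
Proof. by apply/val_inj; rewrite /= /bump leqNgt ltn_ord. Qed.

Definition extend_family n (w : 'I_n -> 'rV[R]_d) x (i : 'I_n.+1) : 'rV[R]_d :=
  oapp w x (unlift ord_max i).

Lemma extend_family_max n (w : 'I_n -> 'rV[R]_d) x : extend_family w x ord_max = x.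
Proof. by rewrite /extend_family unlift_none. Qed.

Lemma extend_family_widen n (w : 'I_n -> 'rV[R]_d) x i :
  extend_family w x (widen_ord (leqnSn n) i) = w i.
Proof.
by rewrite widen_lift_max /extend_family liftK.
Qed.

Lemma extend_family_ind n (w : 'I_n -> 'rV[R]_d) x A :
  (forall i, A (w i)) -> A x -> forall i, A (extend_family w x i).
Proof. by move=> Aw Ax i; rewrite /extend_family; case: unlift => //= j; exact: Aw. Qed.

Lemma affine_span_extend n (w : 'I_n -> 'rV[R]_d) x :
  affine_span w `<=` affine_span (extend_family w x).
Proof.
move=> y; rewrite /affine_span/= => /submx_trans; apply.
apply/row_subP => i; rewrite rowK -(extend_family_widen w x i).
exact: affine_span_mem.
Qed.

(** A family of points of [A] whose lifts have maximal rank spans [A]. *)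
Lemma affine_span_exists A : exists n (w : 'I_n -> 'rV[R]_d),
  (forall i, A (w i)) /\ A `<=` affine_span w.
Proof.
pose P k := `[< exists n (w : 'I_n -> 'rV[R]_d),
  (forall i, A (w i)) /\ \rank (homogeneous_mx w) = k >].
have P0 : exists k, P k.
  exists (\rank (homogeneous_mx (fun _ : 'I_0 => 0 : 'rV[R]_d))).
  by apply/asboolP; exists 0%N, (fun=> 0); split=> // -[].
have Pd k : P k -> (k <= d + 1)%N.
  by move=> /asboolP[n [w [_ <-]]]; exact: rank_leq_col.
have [k /asboolP[n [w [Aw rw]]] kmax] := ex_maxnP P0 Pd.
exists n, w; split=> // y Ay.
have le_w : (homogeneous_mx w <= homogeneous_mx (extend_family w y))%MS.
  apply/row_subP => i; rewrite rowK -(extend_family_widen w y i).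
  exact: affine_span_mem.
have /kmax : P (\rank (homogeneous_mx (extend_family w y))).
  apply/asboolP; exists n.+1, (extend_family w y); split=> //.
  exact: extend_family_ind.
rewrite -rw (geq_leqif (mxrank_leqif_sup le_w)) => /(submx_trans _); apply.
have := affine_span_mem (extend_family w y) ord_max.
by rewrite extend_family_max.
Qed.

Lemma affine_span_neq0 n (w : 'I_n -> 'rV[R]_d) x : affine_span w x -> (0 < n)%N.
Proof.
case: n w => // w; rewrite /affine_span/= => /submxP[a].
rewrite [a]thinmx0 mul0mx => /rowP/(_ (rshift d 0)).
by rewrite row_mxEr !mxE => /eqP; rewrite oner_eq0.
Qed.

(** The barycentre of an affinely spanning family of points of [F] is relatively
    interior to [F], and adding the vertex [x] to the family shows that the
    points between it and [x] are relatively interior to the cone with apex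
    [x]. *)
Lemma relint_cone F x : @convex_set R 'rV[R]_d F -> F !=set0 ->
  exists2 f, relint F f & forall t, 0 < t -> t < 1 ->
    relint (conv_hull (F `|` [set x])) (f + t *: (x - f)).
Proof.
move=> cF [y Fy]; have [n [w [Fw Fsp]]] := affine_span_exists F.
have n0 : (0 < n)%N by apply: (affine_span_neq0 (w := w) (x := y)); exact: Fsp.
have n0R : n%:R != 0 :> R by rewrite pnatr_eq0 -lt0n.
have sum_c (a : R) : \sum_(i < n) a / n%:R = a.
  by rewrite sumr_const card_ord -[LHS]mulr_natr divfK.
pose f := \sum_i (1 / n%:R : R) *: w i.
have f_E : f = n%:R^-1 *: \sum_i w i.
  by rewrite scaler_sumr; apply: eq_bigr => i _; rewrite div1r.
exists f; first by apply: relint_sum => // i; rewrite divr_gt0// ltr0n.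
move=> t t0 t1.
pose c (i : 'I_n.+1) := if unlift ord_max i is Some _ then (1 - t) / n%:R else t.
have c_max : c ord_max = t by rewrite /c unlift_none.
have c_widen i : c (widen_ord (leqnSn n) i) = (1 - t) / n%:R.
  by rewrite widen_lift_max /c liftK.
have -> : f + t *: (x - f) = \sum_i c i *: extend_family w x i.
  rewrite big_ord_recr/= c_max extend_family_max.
  under eq_bigr do rewrite c_widen extend_family_widen.
  rewrite -scaler_sumr -scalerA -f_E scalerBr scalerBl scale1r.
  by rewrite addrA addrAC.
apply: relint_sum.
- exact: convex_conv_hull.
- apply: extend_family_ind => [i|]; apply: sub_conv_hull; [by left|by right].
- move=> z; apply; split.
    exact/affine_set_convex/affine_span_affine.
  move=> v [/Fsp|->]; first exact: affine_span_extend.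
  by rewrite -{2}(extend_family_max w x); exact: affine_span_mem.
- by move=> i; rewrite /c; case: unlift => // _; rewrite divr_gt0 ?ltr0n ?subr_gt0.
- rewrite big_ord_recr/= c_max; under eq_bigr do rewrite c_widen.
  by rewrite sum_c subrK.
Qed.

(** From a relative interior point [f] one can step away from any [g] in [F]
    without leaving [F]. *)
Lemma relint_max_constant F f u : relint F f ->
  (forall g, F g -> inner g u <= inner f u) ->
  forall g, F g -> inner g u = inner f u.
Proof.
move=> [Ff nF] fmax g Fg; apply/eqP; rewrite eq_le fmax//=.
have [e e0 /(_ e)] := interior_step (f - g) nF.
rewrite gtr0_norm// => /(_ (lexx _)) Fe.
have /Fe/fmax : affine_hull F (f + e *: (f - g)).
  move=> B [aB FB]; have := aB f g (1 + e) (FB _ Ff) (FB _ Fg); congr B.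
  have -> : 1 - (1 + e) = - e by ring.
  by rewrite scalerDl scale1r scalerBr scaleNr addrA.
rewrite innerDl innerZl innerBl gerDl pmulr_rle0// subr_le0; exact.
Qed.

End RelativeInterior.

(** * Continuity of finite measures along halfspaces *)

Section FiniteMeasure.
Context {dT : measure_display} {T : measurableType dT} {R : realType}.
Variable mu : {finite_measure set T -> \bar R}.
Local Open Scope ereal_scope.
Implicit Types (A : (set T)^nat) (a : \bar R).

Lemma measure_bigcap_lt A a : (forall n, measurable (A n)) ->
  nonincreasing_seq A -> mu (\bigcap_n A n) < a -> exists n, mu (A n) < a.
Proof.
move=> mA Adecr mua.
have A0 : mu (A 0%N) < +oo by rewrite ltey_eq fin_num_measure.
have := @nonincreasing_cvg_mu _ _ _ mu A A0 mA (bigcapT_measurable mA) Adecr.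
by move=> /(_ _ (open_ereal_lt' mua))[n _ /(_ n (leqnn n))]; exists n.
Qed.

Lemma measure_bigcup_gt A a : (forall n, measurable (A n)) ->
  nondecreasing_seq A -> a < mu (\bigcup_n A n) -> exists n, a < mu (A n).
Proof.
move=> mA Aincr mua.
have := @nondecreasing_cvg_mu _ _ _ mu A mA (bigcupT_measurable A mA) Aincr.
by move=> /(_ _ (open_ereal_gt' mua))[n _ /(_ n (leqnn n))]; exists n.
Qed.

End FiniteMeasure.

Section HalfspaceMeasure.
Context {R : realType} {d : nat}.
Variable mu : {finite_measure set (borelRn R d) -> \bar R}.
Implicit Types (A B H : set 'rV[R]_d) (x y z u v f : 'rV[R]_d) (a : \bar R).

Lemma exists_invn_lt (e : R) : 0 < e -> exists n, n.+1%:R^-1 < e.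
Proof. by move=> /ltr_add_invr[n]; rewrite add0r; exists n. Qed.

Lemma borel_open A : open A -> @measurable _ (borelRn R d) A.
Proof. by move=> oA; apply: sub_sigma_algebra; exact: oA. Qed.

Lemma borel_closed A : closed A -> @measurable _ (borelRn R d) A.
Proof.
move=> cA; rewrite -(setCK A).
apply: (@measurableC _ (borelRn R d)); apply: borel_open; exact: closed_openC.
Qed.

Lemma measurable_halfspace x u : @measurable _ (borelRn R d) (halfspace x u).
Proof. by apply: borel_closed; exact: closed_halfspace. Qed.

Lemma measurable_open_halfspace x u :
  @measurable _ (borelRn R d) (open_halfspace x u).
Proof. by apply: borel_open; exact: open_open_halfspace. Qed.

Lemma le_borel_measure A B : @measurable _ (borelRn R d) A ->
  @measurable _ (borelRn R d) B -> A `<=` B -> (mu A <= mu B)%E.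
Proof. by move=> mA mB AB; apply: le_measure; rewrite ?inE. Qed.

Lemma le_measure_halfspace x y u : inner x u <= inner y u ->
  (mu (halfspace y u) <= mu (halfspace x u))%E.
Proof.
move=> xy; apply: le_borel_measure; try exact: measurable_halfspace.
exact: halfspaceS.
Qed.

Lemma measure_halfspace_split x u : unit_sphere u ->
  mu (bd (halfspace x u)) = 0%E ->
  mu (halfspace x u) = mu (open_halfspace x u).
Proof.
move=> uu bd0; pose B := bd (halfspace x u).
have mB : @measurable _ (borelRn R d) B.
  rewrite /B /bd (interior_halfspace x uu); apply: (@measurableD _ (borelRn R d)).
    by apply: borel_closed; exact: closed_closure.
  exact: measurable_open_halfspace.
have -> : halfspace x u = open_halfspace x u `|` B.
  rewrite /B bd_halfspace//; apply/seteqP; split=> y; rewrite /halfspace/open_halfspace/=.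
    by rewrite le_eqVlt => /predU1P[->|]; [right|left].
  by move=> [/ltW|->].
rewrite measureU//.
- by rewrite -[X in _ = X]adde0; congr (_ + _)%E.
- exact: measurable_open_halfspace.
- rewrite /B bd_halfspace//; apply/seteqP; split=> // y []; rewrite /open_halfspace/=.
  by move=> /[swap] ->; rewrite ltxx.
Qed.

(** Continuity from above along translates. *)
Lemma measure_halfspace_lt_translate x u a : unit_sphere u ->
  (mu (halfspace x u) < a)%E ->
  exists2 e, 0 < e & (mu (halfspace (x - e *: u) u) < a)%E.
Proof.
move=> uu mua.
pose A n : set (borelRn R d) := halfspace (x - n.+1%:R^-1 *: u) u.
have inE_ (e : R) : inner (x - e *: u) u = inner x u - e.
  by rewrite innerBl innerZl (inner_unit uu) mulr1.
have [n nmu] : exists n, (mu (A n) < a)%E.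
  apply: measure_bigcap_lt => [n| |]; first exact: measurable_halfspace.
    move=> m n mn; apply/subsetPset; apply: halfspaceS.
    by rewrite !inE_ lerB// lef_pV2 ?posrE ?ltr0n// ler_nat.
  suff -> : \bigcap_n A n = halfspace x u by [].
  apply/seteqP; split=> [y Ay|y xy n _]; last first.
    by apply: le_trans xy; rewrite inE_ gerBl invr_ge0.
  apply/ler_addgt0Pl => e e0.
  have [n nlt] := exists_invn_lt e0.
  have := Ay n I; rewrite /A/halfspace/= inE_ lerBlDr => /le_trans; apply.
  by rewrite addrC lerD2r ltW.
by exists n.+1%:R^-1; rewrite ?invr_gt0 ?ltr0n.
Qed.

(** Lower semicontinuity of the mass of the open halfspace in both its anchor
    point and its direction: the closed bounded pieces
    [inner f u + 1/k <= inner z u, `|z - f| <= k] exhaust the open halfspace and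
    each of them lies in all sufficiently near halfspaces. *)
Lemma measure_open_halfspace_le f u a : unit_sphere u ->
  (forall e, 0 < e -> exists y v,
    [/\ `|y - f| < e, `|v - u| < e, unit_sphere v & (mu (halfspace y v) <= a)%E]) ->
  (mu (open_halfspace f u) <= a)%E.
Proof.
move=> uu near_fu; rewrite leNgt; apply/negP.
pose A n : set (borelRn R d) :=
  halfspace (f + n.+1%:R^-1 *: u) u `&` [set z | `|z - f| <= n.+1%:R].
have innerA (e : R) : inner (f + e *: u) u = inner f u + e.
  by rewrite innerDl innerZl (inner_unit uu) mulr1.
have -> : open_halfspace f u = \bigcup_n A n.
  apply/seteqP; split=> [z|z [n _ [fz _]]]; last first.
    by apply: lt_le_trans fz; rewrite innerA ltrDl invr_gt0.
  rewrite /open_halfspace/= -subr_gt0 => fz.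
  have [n nlt] := exists_invn_lt fz.
  exists (maxn n (Num.bound `|z - f|)) => //; split.
    rewrite /halfspace/= innerA -lerBrDl; apply: le_trans (ltW nlt).
    by rewrite lef_pV2 ?posrE ?ltr0n// ler_nat ltnS leq_maxl.
  apply: le_trans (ltW (archi_boundP (normr_ge0 _))) _.
  by rewrite ler_nat (leq_trans (leq_maxr n _))// leqnSn.
have mA n : @measurable _ (borelRn R d) (A n).
  apply: (@measurableI _ (borelRn R d)); first exact: measurable_halfspace.
  apply: (@borel_closed [set z | `|z - f| <= n.+1%:R]).
  have -> : [set z | `|z - f| <= n.+1%:R] = closed_ball f n.+1%:R.
    rewrite closed_ballE//.
    by apply/seteqP; split=> z; rewrite /closed_ball_/= distrC.
  exact: closed_ball_closed.
move=> /measure_bigcup_gt[//||n].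
  move=> m n mn; apply/subsetPset => z [zm zf]; split.
    apply: le_trans zm; rewrite !innerA lerD2l.
    by rewrite lef_pV2 ?posrE ?ltr0n// ler_nat ltnS.
  by apply: le_trans zf _; rewrite ler_nat ltnS.
have n0 : 0 < n.+1%:R^-1 :> R by rewrite invr_gt0.
have [e e0 stable] := inner_stable (d := d) n0 (ler0n R n.+1).
have [y [v [yf vu vv muyv]]] := near_fu e e0.
rewrite ltNge => /negP; apply; apply: le_trans muyv.
apply: le_borel_measure; [exact: mA|exact: measurable_halfspace|].
move=> z [+ zf]; rewrite /halfspace/= innerA -lerBrDl -innerBl => fz.
by rewrite -subr_ge0 -innerBl ltW// (stable z f y u v)// unit_sphere_norm.
Qed.

End HalfspaceMeasure.

(** * Compactness of depth regions *)

Section DepthRegion.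
Context {R : realType} {d : nat}.
Variables (mu : {finite_measure set (borelRn R d) -> \bar R}) (alpha : R).
Implicit Types (A F S H : set 'rV[R]_d) (x y z u v f w : 'rV[R]_d).
Local Notation D := (depth_region mu alpha).

Lemma depth_region_le z x u : D z -> unit_sphere u -> inner x u <= inner z u ->
  (alpha%:E <= mu (halfspace x u))%E.
Proof.
move=> Dz uu xz; apply: le_trans (le_measure_halfspace mu xz).
apply: le_trans Dz _; apply: ereal_inf_lbound.
by exists (halfspace z u) => //; exists u.
Qed.

Lemma depth_region_outside z x u : unit_sphere u ->
  (mu (halfspace x u) < alpha%:E)%E -> inner x u <= inner z u -> ~ D z.
Proof. by move=> uu + xz Dz; rewrite ltNge (depth_region_le Dz uu xz). Qed.

Lemma not_depth_region x : ~ D x ->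
  exists2 u, unit_sphere u & (mu (halfspace x u) < alpha%:E)%E.
Proof.
move=> /negP; rewrite -ltNge => /ereal_inf_ltP[_ [_ [u uu <-] <-]] mux.
by exists u.
Qed.

(** A light halfspace through [x] stays light when translated slightly outwards,
    and then it is a neighbourhood of [x] that misses the region. *)
Lemma closed_depth_region : closed D.
Proof.
rewrite -[D]setCK; apply: open_closedC; rewrite openE => x /not_depth_region[u uu].
move=> /(measure_halfspace_lt_translate uu)[e e0 mue].
have : nbhs x (open_halfspace (x - e *: u) u).
  apply: open_nbhs_nbhs; split; first exact: open_open_halfspace.
  by rewrite /open_halfspace/= innerBl innerZl (inner_unit uu) mulr1 gtrBl.
by apply: filterS => z /ltW; exact: depth_region_outside.
Qed.

Lemma closure_depth_region : closure D = D.
Proof. by have /closure_id <- := closed_depth_region. Qed.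

(** Almost all the mass lies in some ball; a point far outside it, in the sense
    of some coordinate, anchors a coordinate halfspace disjoint from that ball,
    hence light. *)
Lemma compact_depth_region : D <> setT -> compact D.
Proof.
move=> DT; apply: bounded_closed_compact; last exact: closed_depth_region.
have [x /not_depth_region[u0 _ mux]] : exists x, ~ D x.
  by apply/existsNP => DallT; apply: DT; apply/seteqP; split.
(* the region being proper forces a positive level *)
have a0 : (0 < alpha%:E)%E by apply: le_lt_trans mux; exact: measure_ge0.
pose A n : set (borelRn R d) := ~` [set z : 'rV[R]_d | `|z| <= n%:R].
have mA n : measurable (A n).
  apply: borel_open; apply: closed_openC.
  have -> : [set z : 'rV[R]_d | `|z| <= n%:R] =
    (fun z : 'rV[R]_d => `|z|) @^-1` [set r | r <= n%:R] by [].
  apply: closed_comp => [z _|]; [exact: norm_continuous|exact: closed_le].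
have [n mun] : exists n, (mu (A n) < alpha%:E)%E.
  apply: measure_bigcap_lt => // [m n mn|].
    apply/subsetPset => z; apply: contra_not => /= /le_trans; apply.
    by rewrite ler_nat.
  suff -> : \bigcap_n A n = set0 by rewrite measure0.
  apply/seteqP; split=> // z /(_ (Num.bound `|z|) I); apply.
  by rewrite /= ltW// archi_boundP.
exists n%:R; split; first exact: num_real.
move=> M nM z Dz; apply: le_trans (ltW nM); rewrite leNgt; apply/negP.
rewrite {1}/Num.norm/= mx_normrE => /bigmax_gtP[|]; first by rewrite ltrn0.
move=> [[i0 i] _ /=]; rewrite (ord1 i0) => nzi.
pose s := Num.sg (z 0 i).
have zi0 : z 0 i != 0 by rewrite -normr_gt0; apply: le_lt_trans nzi.
have inner_delta y : inner y (s *: delta_mx 0 i) = s * y 0 i.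
  rewrite innerC innerZl /inner (bigD1 i)//= big1 => [|j ji].
    by rewrite mxE !eqxx mul1r addr0.
  by rewrite mxE (negbTE ji) andbF mul0r.
have uu : unit_sphere (s *: delta_mx 0 i : 'rV[R]_d).
  by rewrite /unit_sphere/= inner_delta !mxE !eqxx mulr1 -expr2 sqr_sg zi0.
have := depth_region_le Dz uu (lexx _); rewrite leNgt => /negP; apply.
apply: le_lt_trans mun; apply: le_borel_measure => //.
  exact: measurable_halfspace.
move=> y; rewrite /halfspace/A/= !inner_delta => zy.
apply/negP; rewrite -ltNge; apply: lt_le_trans (coord_le_norm y i).
apply: lt_le_trans nzi _; rewrite normrEsg; apply: le_trans zy _.
by apply: le_trans (ler_norm _) _; rewrite normrM normr_sg zi0 mul1r.
Qed.

(** * Limits of halfspaces that miss the region *)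

(** What limits of light halfspaces retain: both the separation from the region
    and the mass bound lose strictness, and the bound survives only for the
    interior. *)
Definition supporting f u : Prop :=
  [/\ unit_sphere u, forall z, D z -> inner z u <= inner f u
    & (mu (open_halfspace f u) <= alpha%:E)%E].

(** A cluster point, on the compact sphere, of the filter generated by the
    normals of the light halfspaces through points of [S] close to [f]. *)
Lemma limit_direction f S : closure S f -> S `<=` ~` D ->
  exists2 u, unit_sphere u & forall e, 0 < e -> exists y v,
    [/\ S y, `|y - f| < e, `|v - u| < e, unit_sphere v
      & (mu (halfspace y v) < alpha%:E)%E].
Proof.
move=> Sf SD.
pose B (e : R) : set 'rV[R]_d := [set v | unit_sphere v /\
  exists y, [/\ S y, `|y - f| < e & (mu (halfspace y v) < alpha%:E)%E]].
pose G := filter_from [set e : R | 0 < e] B.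
have GG : ProperFilter G.
  apply: filter_from_proper => [|e /= e0].
    apply: filter_from_filter; first by exists 1; exact: ltr01.
    move=> e1 e2 /= e10 e20; exists (Num.min e1 e2); first by rewrite /= lt_min e10.
    move=> v [vv [y [Sy]]]; rewrite lt_min => /andP[ye1 ye2] muy.
    by split; split=> //; exists y.
  have [y [Sy]] := Sf _ (nbhsx_ballx f e e0).
  rewrite -ball_normE/= distrC => yf.
  by have [v vv muy] := not_depth_region (SD _ Sy); exists v; split=> //; exists y.
have GS : G (@unit_sphere R d) by exists 1; [exact: ltr01|move=> v []].
have [u [uu clu]] := compact_unit_sphere GG GS.
exists u => // e e0.
have GB : G (B e) by exists e.
have [v [[vv [y [Sy yf muy]]]]] := clu _ _ GB (nbhsx_ballx u e e0).
by rewrite -ball_normE/= distrC => vu; exists y, v.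
Qed.

(** Were a point of the region strictly inside the limit halfspace, it would be
    inside some light one.  The last clause says which points the halfspace
    contains when [f] is approached along a ray of direction [w]: a light
    halfspace through [f + t *: w] excludes [f], so its normal has positive
    product with [w]. *)
Lemma supporting_limit f S : closure S f -> S `<=` ~` D ->
  exists2 u, supporting f u & forall w, D f ->
    (forall y, S y -> exists2 t, 0 < t & y = f + t *: w) -> 0 <= inner w u.
Proof.
move=> Sf SD; have [u uu limu] := limit_direction Sf SD; exists u.
  split=> // [z Dz|]; last first.
    apply: measure_open_halfspace_le => // e /limu[y [v [_ yf vu vv /ltW muy]]].
    by exists y, v.
  rewrite leNgt -subr_gt0 -innerBl; apply/negP => zf.
  have [e e0 stable] := inner_stable (d := d) zf (normr_ge0 (z - f)).
  have [y [v [_ yf vu vv muy]]] := limu e e0.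
  apply: (depth_region_outside vv muy _ Dz).
  rewrite -subr_ge0 -innerBl ltW// (stable z f y u v)//.
  exact: unit_sphere_norm.
move=> w Df Sray; rewrite leNgt; apply/negP => wu.
have w0 : 0 < inner (- w - 0) u.
  by rewrite subr0 -scaleN1r innerZl mulN1r oppr_gt0.
have [e e0 stable] := inner_stable (d := d) w0 (normr_ge0 (- w - 0)).
have [y [v [Sy _ vu vv muy]]] := limu e e0.
have [t t0 yE] := Sray _ Sy.
apply: (depth_region_outside vv muy _ Df).
rewrite yE innerDl innerZl gerDl pmulr_rle0//.
have : 0 < inner (- w - 0) v.
  by apply: (stable _ 0 0 u v) => //; rewrite ?subrr ?normr0// unit_sphere_norm.
by rewrite subr0 -scaleN1r innerZl mulN1r oppr_gt0 => /ltW.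
Qed.

Lemma supporting_boundary f : ~ interior D f -> exists u, supporting f u.
Proof.
move=> nDf; have : closure (~` D) f.
  by rewrite -[closure _]setCK -interiorC setCK.
by move=> /supporting_limit[//|u su _]; exists u.
Qed.

Lemma closure_ray f w :
  closure [set y | exists2 t, 0 < t < 1 & y = f + t *: w] f.
Proof.
move=> B /(interior_step w)[e e0 eB].
pose t := Num.min e 1 / 2.
have t0 : 0 < t by rewrite divr_gt0// lt_min e0 ltr01.
have [te t1] : t <= e /\ t < 1.
  have := ge_min e e 1; have := ge_min 1 e 1; rewrite !lexx orbT/= /t; lra.
exists (f + t *: w); split; first by exists t; rewrite ?t0.
by apply: eB; rewrite gtr0_norm.
Qed.

Lemma supporting_ray f x : D f ->
  (forall t, 0 < t -> t < 1 -> ~ D (f + t *: (x - f))) ->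
  exists2 u, supporting f u & halfspace f u x.
Proof.
move=> Df ray; have := @closure_ray f (x - f).
move=> /supporting_limit[_ [t /andP[t0 t1] ->]|u su rayu]; first exact: ray.
exists u => //; rewrite /halfspace/= -subr_ge0 -innerBl; apply: rayu => //.
by move=> y [t /andP[t0 _] ->]; exists t.
Qed.

(** Walking from a nearest point towards [x] brings one strictly closer to
    [x], hence out of the region. *)
Lemma nearest_depth_region x : D !=set0 -> ~ D x ->
  exists2 f, D f & forall t, 0 < t -> t < 1 -> ~ D (f + t *: (x - f)).
Proof.
move=> D0 nDx; have cD : compact D.
  by apply: compact_depth_region => DT; apply: nDx; rewrite DT.
have cont : continuous (fun z : 'rV[R]_d => `|x - z|).
  move=> z; apply: (@continuous_comp _ _ _ (fun y : 'rV[R]_d => x - y)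
    (fun y : 'rV[R]_d => `|y|)).
    by apply: (@continuousB _ _ _ (cst x) id); [exact: cst_continuous|move=> A].
  exact: norm_continuous.
have [f] := EVT_min_rV D0 cD (continuous_subspaceT cont).
rewrite inE => Df fmin; exists f => // t t0 t1 Dt.
have xf : 0 < `|x - f|.
  by rewrite normr_gt0 subr_eq0; apply: contra_not_neq nDx => ->.
have := fmin (f + t *: (x - f)); rewrite inE => /(_ Dt).
rewrite opprD addrA -{2}(scale1r (x - f)) -scalerBl normrZ gtr0_norm ?subr_gt0//.
by rewrite leNgt gtr_pMl// gtrBl t0.
Qed.

(** The covering of the complement needs no face: a nearest point of the region
    replaces the face, so that no face visible from [x] has to be exhibited. *)
Lemma supporting_through x : D !=set0 -> ~ interior D x ->
  exists f u, [/\ D f, supporting f u & halfspace f u x].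
Proof.
move=> D0 nDx; have [Dx|/(nearest_depth_region D0)[f Df ray]] := pselect (D x).
  by have [u su] := supporting_boundary nDx; exists x, u; split=> //; exact: lexx.
by have [u su ux] := supporting_ray Df ray; exists f, u.
Qed.

(** Visibility says exactly what is needed to approach a relative interior point
    of [F] from [x] outside the region. *)
Lemma supporting_visible x F : D !=set0 -> ~ interior D x ->
  visible_faces x D F ->
  exists f u, [/\ D f, supporting f u, halfspace f u x & F `<=` bd (halfspace f u)].
Proof.
move=> D0 nDx [[cF]]; rewrite closure_depth_region => FD _ vis.
have bd_sub f u : relint F f -> supporting f u -> F `<=` bd (halfspace f u).
  move=> Ff [uu uD _]; rewrite bd_halfspace//.
  by apply: relint_max_constant => // g /FD/uD.
case: vis => [[nDx' cone0]|[_ Fx]]; last first.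
  have [u su] := supporting_boundary nDx; exists x, u.
  have Dx : D x by apply: FD; case: Fx.
  by split=> //; [exact: lexx|exact: bd_sub].
have [->|/set0P F0] := eqVneq F set0.
  by have [f [u [Df su ux]]] := supporting_through D0 nDx; exists f, u; split.
have [f Ff cone] := relint_cone x cF F0.
have Df : D f by apply: FD; case: Ff.
have [t t0 t1 Dt|u su ux] := @supporting_ray f x Df.
  by rewrite -[False]/(set0 (f + t *: (x - f))) -cone0; split=> //; exact: cone.
by exists f, u; split=> //; exact: bd_sub.
Qed.

End DepthRegion.

(** * Touching halfspaces *)

Section Touching.
Context {R : realType} {d : nat}.
Variables (mu : {finite_measure set (borelRn R d) -> \bar R}) (alpha : R).
Implicit Types (A F S H : set 'rV[R]_d) (x y z u v f w : 'rV[R]_d).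
Local Notation D := (depth_region mu alpha).

(** From a point of [H] interior to [A], a small step along the inner normal
    leads into the interior of [H] without leaving [A]. *)
Lemma touching_disjoint A H x : touching A H -> interior A x -> ~ H x.
Proof.
move=> [[y _ [u uu <-]]] tA Ax yx; have Ax' := interior_subset Ax.
have [_ ] := tA (ex_intro _ x Ax'); rewrite interior_halfspace//.
have [e e0 /(_ e)] := interior_step u Ax.
rewrite gtr0_norm// => /(_ (lexx _)) Ae /seteqP[/(_ (x + e *: u)) + _]; apply.
split=> //; rewrite /open_halfspace/= innerDl innerZl (inner_unit uu) mulr1.
by apply: le_lt_trans yx _; rewrite ltrDl.
Qed.

Lemma touching_maximizer f u : D f -> unit_sphere u ->
  (forall z, D z -> inner z u <= inner f u) -> touching D (halfspace f u).
Proof.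
move=> Df uu uD; split=> [|_]; first exact: halfspaces_halfspace.
rewrite closure_depth_region interior_halfspace//; split.
  by exists f; split=> //; exact: lexx.
apply/seteqP; split=> // z [+ /uD]; rewrite /open_halfspace/= ltNge.
by move=> /negP.
Qed.

(** Slide the bounding hyperplane until the mass, which varies continuously
    because hyperplanes are null, equals the prescribed level. *)
Lemma exists_halfspace_level x u : unit_sphere u ->
  (forall y, mu (bd (halfspace y u)) = 0%E) ->
  (mu (halfspace x u) < alpha%:E)%E -> (alpha%:E < mu setT)%E ->
  exists2 y, halfspace y u x & mu (halfspace y u) = alpha%:E.
Proof.
move=> uu bd0 mux muT.
have innerE (t : R) : inner (t *: u) u = t by rewrite innerZl (inner_unit uu) mulr1.
pose E := [set t : R | (alpha%:E <= mu (halfspace (t *: u) u))%E].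
have ubE t s : E t -> (mu (halfspace (s *: u) u) < alpha%:E)%E -> t <= s.
  move=> Et mus; rewrite leNgt; apply/negP => st.
  have := lt_le_trans mus Et; rewrite ltNge => /negP; apply.
  by apply: le_measure_halfspace; rewrite !innerE ltW.
have Ex : ubound E (inner x u).
  move=> t Et; apply: ubE Et _; apply: le_lt_trans mux.
  by apply: le_measure_halfspace; rewrite innerE.
have supE : has_sup E.
  split; last by exists (inner x u).
  pose A n : set (borelRn R d) := halfspace (- n%:R *: u) u.
  have [n nmu] : exists n, (alpha%:E < mu (A n))%E.
    apply: measure_bigcup_gt => [n||]; first exact: measurable_halfspace.
      move=> m n mn; apply/subsetPset; apply: halfspaceS.
      by rewrite !innerE lerN2 ler_nat.
    suff -> : \bigcup_n A n = setT by [].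
    apply/seteqP; split=> // z _; exists (Num.bound `|inner z u|) => //.
    rewrite /A/halfspace/= innerE lerNl; apply: le_trans (ler_norm _) _.
    by rewrite normrN ltW// archi_boundP.
  by exists (- n%:R); exact: ltW.
exists (sup E *: u).
  by rewrite /halfspace/= innerE; apply: ge_sup => //; case: supE.
apply/eqP; rewrite eq_le; apply/andP; split.
  rewrite measure_halfspace_split//; apply: measure_open_halfspace_le => // e e0.
  exists ((sup E + e / 2) *: u), u; split=> //; last 1 first.
  - rewrite leNgt; apply/negP => /ltW/(sup_upper_bound supE).
    by rewrite leNgt ltrDl divr_gt0.
  - rewrite -scalerBl addrAC subrr add0r normrZ gtr0_norm ?divr_gt0//.
    rewrite (@le_lt_trans _ _ (e / 2 * 1))//; last lra.
    by rewrite ler_wpM2l ?unit_sphere_norm// divr_ge0// ltW.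
  - by rewrite subrr normr0.
rewrite leNgt; apply/negP => /(measure_halfspace_lt_translate uu)[e e0].
rewrite -scalerBl => mue; have [t Et] := sup_adherent e0 supE.
by rewrite ltNge (ubE _ _ Et mue).
Qed.

(** The general bound and the exact mass of the smooth case are asked of the same
    halfspace, so that one selection serves both. *)
Definition adequate x H : Prop :=
  [/\ touching D H, H x, (mu (interior H) <= alpha%:E)%E
    & smooth_at mu D -> (D = set0 -> level_reached mu alpha) ->
      mu H = alpha%:E].

(** Under smoothness the mass is squeezed: the interior has mass at most [alpha],
    the boundary is null, and [f] has depth at least [alpha]. *)
Lemma adequate_supporting x f u : D f -> supporting mu alpha f u ->
  halfspace f u x -> adequate x (halfspace f u).
Proof.
move=> Df [uu uD muf] ux.
have tD := touching_maximizer Df uu uD.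
split=> //; first by rewrite interior_halfspace.
move=> [_ /(_ _ tD) bd0] _; apply/eqP; rewrite eq_le.
by rewrite (depth_region_le Df)// measure_halfspace_split// muf.
Qed.

(** Every halfspace touches the empty set, so only the mass matters.  If the
    total mass exceeds [alpha] a light halfspace through [x] can be enlarged to
    the right mass; otherwise a halfspace reaching the level, if there is one,
    already carries the whole measure, and it can be enlarged to contain [x]. *)
Lemma adequate_set0 x : D = set0 -> exists H, adequate x H.
Proof.
move=> D0; have tD y u : unit_sphere u -> touching D (halfspace y u).
  move=> uu; split; first exact: halfspaces_halfspace.
  by rewrite D0 => /set0P/eqP.
have interior_le y u (a : \bar R) : unit_sphere u -> (mu (halfspace y u) <= a ->
    mu (interior (halfspace y u)) <= a)%E.
  move=> uu; apply: le_trans; rewrite interior_halfspace//.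
  apply: le_borel_measure; [exact: measurable_open_halfspace|
    exact: measurable_halfspace|exact: open_halfspaceW].
have [u uu mux] : exists2 u, unit_sphere u & (mu (halfspace x u) < alpha%:E)%E.
  by apply: not_depth_region; rewrite D0.
have [[sm lev]|nsl] :=
    pselect (smooth_at mu D /\ (D = set0 -> level_reached mu alpha)); last first.
  exists (halfspace x u); split=> [|||sm lev]; [exact: tD|exact: lexx| |].
    by apply: interior_le => //; exact: ltW.
  by exfalso; apply: nsl.
suff [y [v [vv yx muy]]] : exists y v,
    [/\ unit_sphere v, halfspace y v x & mu (halfspace y v) = alpha%:E].
  by exists (halfspace y v); split=> //; [exact: tD|apply: interior_le; rewrite ?muy].
have [muT|muT] := ltP alpha%:E (mu setT).
  have [|y yx muy] := exists_halfspace_level uu _ mux muT; last by exists y, u.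
  by move=> y; apply: sm.2; exact: tD.
have [_ [y0 _ [v vv <-]] mu0] := lev D0.
have eq_alpha y : inner y v <= inner y0 v -> mu (halfspace y v) = alpha%:E.
  move=> yy0; apply/eqP; rewrite eq_le; apply/andP; split.
    apply: le_trans muT; apply: le_borel_measure => //.
    exact: measurable_halfspace.
  by apply: le_trans mu0 _; exact: le_measure_halfspace.
have [xy0|y0x] := leP (inner x v) (inner y0 v).
  by exists x, v; split=> //; [exact: lexx|exact: eq_alpha].
by exists y0, v; split=> //; [exact: ltW|exact: eq_alpha].
Qed.

Lemma adequate_exists x : ~ interior D x -> exists H, adequate x H.
Proof.
move=> nDx; have [/adequate_set0//|/set0P D0] := eqVneq D set0.
have [f [u [Df su ux]]] := supporting_through D0 nDx.
by exists (halfspace f u); exact: adequate_supporting.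
Qed.

Lemma adequate_along x F : ~ interior D x -> visible_faces x D F ->
  exists2 H, adequate x H & F `<=` bd H.
Proof.
move=> nDx vF; have [D0|/set0P D0] := eqVneq D set0.
  have [H aH] := adequate_set0 x D0; exists H => //.
  by case: vF => -[_ + _] _; rewrite closure_depth_region D0 => F0 y /F0.
have [f [u [Df su ux Fbd]]] := supporting_visible D0 nDx vF.
by exists (halfspace f u) => //; exact: adequate_supporting.
Qed.

(** If [H] met the interior of the region, a slightly smaller parallel halfspace
    would still strictly contain the halfspace touching the region in the same
    direction, whose mass is at least [alpha]. *)
Lemma contiguous_disjoint H x : contiguous_support_at mu D -> halfspaces H ->
  (mu (interior H) <= alpha%:E)%E -> interior D x -> ~ H x.
Proof.
move=> [DT contig] [y _ [u uu <-]]; rewrite interior_halfspace// => muy Dx yx.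
have step : interior (interior D) x by have /interior_id -> := @open_interior _ D.
have [e e0 /(_ e)] := interior_step u step.
rewrite gtr0_norm// => /(_ (lexx _)); set z := x + _ => Dz.
have inner_z : inner z u = inner x u + e.
  by rewrite innerDl innerZl (inner_unit uu) mulr1.
have D0 : D !=set0 by exists x; exact: interior_subset.
have [p] := EVT_max_rV D0 (compact_depth_region DT)
  (continuous_subspaceT (@continuous_innerl R d u)).
rewrite inE => Dp pmax.
have zp : inner z u < inner p u.
  have [s s0 /(_ s)] := interior_step u Dz.
  rewrite gtr0_norm// => /(_ (lexx _)) Ds.
  have := pmax (z + s *: u); rewrite inE => /(_ Ds).
  by rewrite innerDl innerZl (inner_unit uu) mulr1; apply: lt_le_trans; rewrite ltrDl.
have tp : touching D (halfspace p u).
  by apply: touching_maximizer => // q Dq; apply: pmax; rewrite inE.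
have pz : halfspace p u `<` halfspace z u.
  rewrite properEneq; split; last by apply: halfspaceS; exact: ltW.
  apply/eqP => pzE; have : halfspace p u z by rewrite pzE; exact: lexx.
  by rewrite /halfspace/= leNgt zp.
have bdz : bd (halfspace z u) `&` interior D !=set0.
  by exists z; split=> //; rewrite bd_halfspace.
have := contig _ _ tp (halfspaces_halfspace z uu) pz bdz.
rewrite ltNge => /negP; apply.
apply: le_trans (depth_region_le Dp uu (lexx _)).
apply: le_trans muy; apply: le_borel_measure.
- exact: measurable_halfspace.
- exact: measurable_open_halfspace.
- move=> q; apply: lt_le_trans; rewrite inner_z.
  by apply: le_lt_trans yx _; rewrite ltrDl.
Qed.

End Touching.

Local Open Scope ereal_scope.

Theorem theorem5 (R : realType) (d : nat)
    (mu : {finite_measure set (borelRn R d) -> \bar R}) (alpha : R) :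
  let D := depth_region mu alpha in
  exists Hsel : 'rV[R]_d -> set 'rV[R]_d -> set 'rV[R]_d,
    (forall (x : 'rV[R]_d) (F : set 'rV[R]_d),
       ~ interior D x -> visible_faces x D F ->
       [/\ touching_along D F (Hsel x F), Hsel x F x
         & mu (interior (Hsel x F)) <= alpha%:E])
    /\ ~` interior D =
         \bigcup_(H in [set H | touching D H /\ mu (interior H) <= alpha%:E]) H
    /\ (smooth_at mu D -> (D = set0 -> level_reached mu alpha) ->
         (forall (x : 'rV[R]_d) (F : set 'rV[R]_d),
            ~ interior D x -> visible_faces x D F ->
            mu (Hsel x F) = alpha%:E)
         /\ ~` interior D =
              \bigcup_(H in [set H | touching D H /\ mu H = alpha%:E]) H)
    /\ (contiguous_support_at mu D ->
         ~` interior D =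
           \bigcup_(H in [set H | halfspaces H /\
                                  mu (interior H) <= alpha%:E]) H)
    /\ (smooth_at mu D -> contiguous_support_at mu D ->
        (D = set0 -> level_reached mu alpha) ->
         ~` interior D =
           \bigcup_(H in [set H | halfspaces H /\ mu H = alpha%:E]) H).
Proof.
move=> D.
have interior_le H : halfspaces H -> mu H = alpha%:E -> mu (interior H) <= alpha%:E.
  move=> [y _ [u uu <-]] <-; rewrite interior_halfspace//; apply: le_borel_measure.
  - exact: measurable_open_halfspace.
  - exact: measurable_halfspace.
  - exact: open_halfspaceW.
pose Hsel x F := xget set0 [set H | adequate mu alpha x H /\ F `<=` bd H].
have selP x F : ~ interior D x -> visible_faces x D F ->
    adequate mu alpha x (Hsel x F) /\ F `<=` bd (Hsel x F).
  move=> nDx vF; have [H aH FH] := adequate_along nDx vF.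
  by apply: (@xgetPex _ set0 [set H | adequate mu alpha x H /\ F `<=` bd H]); exists H.
exists Hsel; split; last split; last split; last split.
- by move=> x F nDx vF; have [[tH Hx muH _] FH] := selP x F nDx vF; split.
- apply/seteqP; split=> [x /adequate_exists[H [tH Hx muH _]]|x [H [tH _] Hx] Dx].
    by exists H.
  exact: touching_disjoint tH Dx Hx.
- move=> sm lev; split.
    by move=> x F nDx vF; have [[_ _ _ /(_ sm lev)]] := selP x F nDx vF.
  apply/seteqP; split=> [x /adequate_exists[H [tH Hx _ /(_ sm lev) muH]]|].
    by exists H.
  by move=> x [H [tH _] Hx] Dx; exact: touching_disjoint tH Dx Hx.
- move=> contig; apply/seteqP; split=> [x /adequate_exists[H [[hH _] Hx muH _]]|].
    by exists H.
  by move=> x [H [hH muH] Hx] Dx; exact: contiguous_disjoint contig hH muH Dx Hx.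
- move=> sm contig lev; apply/seteqP; split.
    by move=> x /adequate_exists[H [[hH _] Hx _ /(_ sm lev) muH]]; exists H.
  move=> x [H [hH muH] Hx] Dx.
  exact: contiguous_disjoint contig hH (interior_le H hH muH) Dx Hx.
Qed.
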